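(* For every integer $r\ge0$, $$S_r(X_1,\dots,X_r;Z):=\exp_C(\mathcal{L}_r(X_1,\dots,X_r;Z))\in A[X_1,\dots,X_r,Z,\tau(X_1),\dots,\tau(X_r),\tau(Z),\dots],$$ i.e. all coefficients of $S_r$ lie in $A[\tau^m(X_j):1\le j\le r,m\ge0]$ and only finitely many of them are nonzero.
   Context: $k$ finite with $q$ elements, $A=k[\theta]$, $A_{+,d}$ monic polynomials of degree $d$, $K=k(\theta)$, $\mathbb{C}_\infty$ the completion of an algebraic closure of $k((1/\theta))$. Let $\mathcal{B}_r=\mathbb{C}_\infty[\tau^m(X_j):1\le j\le r,\ m\ge0]$ be a polynomial ring in the infinitely many indeterminates $\tau^m(X_j)$ (with $\tau^0(X_j)=X_j$), with the ring endomorphism $\tau$ given by $c\mapsto c^q$ on $\mathbb{C}_\infty$ and $\tau^m(X_j)\mapsto\tau^{m+1}(X_j)$. Let $\mathcal{A}_r$ be the set of formal series $\sum_{i\ge0}c_i\tau^i(Z)$ with $c_i\in\mathcal{B}_r$, with termwise addition and product $(\sum_if_i\tau^i(Z))\cdot(\sum_jg_j\tau^j(Z))=\sum_k(\sum_{i+j=k}f_i\tau^i(g_j))\tau^k(Z)$; extend $\tau$ to $\mathcal{A}_r$ by $\tau(\sum c_i\tau^i(Z))=\sum\tau(c_i)\tau^{i+1}(Z)$. The polynomial ring $A[X_j,\tau(X_j),\dots,Z,\tau(Z),\dots]$ is identified with the elements $\sum c_i\tau^i(Z)$ with all $c_i\in A[\tau^m(X_j)]$ and $c_i=0$ for $i$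 large. The Carlitz module is $C:A\to A[\tau]$ with $C_\theta=\theta+\tau$; for $a\in A$ with $C_a=\sum_i a_i\tau^i$, put $C_a(X_j)=\sum_ia_i\tau^i(X_j)$. Define $\mathcal{L}_r(X_1,\dots,X_r;Z)=\sum_{d\ge0}\bigl(\sum_{a\in A_{+,d}}C_a(X_1)\cdots C_a(X_r)a^{-1}\bigr)\tau^d(Z)\in\mathcal{A}_r$. With $D_0=1$, $D_i=(\theta^{q^i}-\theta)D_{i-1}^q$, set $\exp_C(F)=\sum_{i\ge0}D_i^{-1}\tau^i(F)$ for $F\in\mathcal{A}_r$ (each coefficient of $\tau^k(Z)$ is a finite sum). *)

(* Defs.v *)
From HB Require Import structures.
From mathcomp Require Import all_boot all_order all_algebra.
From mathcomp Require Import finmap.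
From mathcomp Require Import qpoly finfield.
From mathcomp Require Import reals.
From mathcomp.multinomials Require Import monalg.

Set Implicit Arguments.
Unset Strict Implicit.
Unset Printing Implicit Defensive.

Import Order.TTheory GRing.Theory Num.Theory.
Local Open Scope ring_scope.

(* Throughout, k is the finite field with q = #|k| elements, A = {poly k} with
   theta = 'X, and K = k(theta) = {fraction {poly k}}. *)

Local Notation "x %:F" := (tofrac x).

(** * The field C_infty *)

Section Cinfty.
Variables (k : finFieldType) (R : realType) (C : fieldType).
Variables (iota : {rmorphism {fraction {poly k}} -> C}) (abs : C -> R).

Definition cvg_abs (u : nat -> C) (x : C) : Prop :=
  forall e : R, 0 < e ->
    exists N : nat, forall n, (N <= n)%N -> abs (u n - x) < e.

Definition cauchy_abs (u : nat -> C) : Prop :=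
  forall e : R, 0 < e ->
    exists N : nat, forall m n, (N <= m)%N -> (N <= n)%N -> abs (u m - u n) < e.

(* k((1/theta)) inside C: the sums theta^n * (c_0 + c_1/theta + ...). *)
Definition in_Kinfty (x : C) : Prop :=
  exists (n : nat) (c : nat -> k),
    cvg_abs (fun N => \sum_(i < N) iota ((c i)%:P%:F * 'X%:F ^+ n / 'X%:F ^+ i)) x.

(* The algebraic closure of k((1/theta)) inside C. *)
Definition in_Kinfty_bar (x : C) : Prop :=
  exists p : {poly C}, [/\ p != 0, forall i, in_Kinfty p`_i & root p x].

(* (C, iota, abs) is a completion of an algebraic closure of k((1/theta)), for
   the absolute value extending |f| = q ^ deg f on A.  Such a triple is unique
   up to isomorphism.  The ultrametric inequality and |theta| = q determine abs
   on K, since elements of k^* are roots of unity and so have absolute value 1. *)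
Record is_Cinfty : Prop := IsCinfty {
  Cinfty_abs_ge0 : forall x, 0 <= abs x;
  Cinfty_abs_eq0 : forall x, abs x = 0 <-> x = 0;
  Cinfty_absM : forall x y, abs (x * y) = abs x * abs y;
  Cinfty_absD : forall x y, abs (x + y) <= Num.max (abs x) (abs y);
  Cinfty_abs_theta : abs (iota 'X%:F) = #|k|%:R;
  Cinfty_complete : forall u, cauchy_abs u -> exists x, cvg_abs u x;
  Cinfty_bar_closed : forall p : {poly C}, (1 < size p)%N ->
    (forall i, in_Kinfty_bar p`_i) -> exists2 x, in_Kinfty_bar x & root p x;
  Cinfty_bar_dense : forall (x : C) (e : R), 0 < e ->
    exists2 y, in_Kinfty_bar y & abs (x - y) < e
}.

End Cinfty.

(** * The Carlitz module *)

Section Carlitz.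
Variable k : finFieldType.

(* A[tau] is represented by {poly {poly k}}, the outer variable standing for
   tau, with the twisted product determined by tau * b = b ^ q * tau. *)
Definition tmul (f g : {poly {poly k}}) : {poly {poly k}} :=
  \sum_(i < size f) \sum_(j < size g)
    (f`_i * g`_j ^+ (#|k| ^ i)) *: 'X^(i + j).

Definition carlitz_theta : {poly {poly k}} := 'X%:P + 'X.

(* The k-algebra morphism A -> A[tau] with theta |-> theta + tau. *)
Definition carlitz (a : {poly k}) : {poly {poly k}} :=
  \sum_(n < size a) (a`_n)%:P *: iter n (tmul carlitz_theta) 1.

Lemma carlitz_polyX : carlitz 'X = carlitz_theta.
Proof.
rewrite /carlitz size_polyX big_ord_recl big_ord1 /= !coefX /= scale0r add0r scale1r.
rewrite /tmul size_poly1; under eq_bigr => i _ do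
  rewrite big_ord1 /= coef1 /= expr1n mulr1 addn0.
by rewrite -[RHS]coefK poly_def.
Qed.

Fixpoint carlitz_D (i : nat) : {poly k} :=
  if i is i'.+1 then ('X ^+ (#|k| ^ i) - 'X) * carlitz_D i' ^+ #|k| else 1.

End Carlitz.

(** * The rings B_r and A_r *)

Lemma malgCM (K : conomType) (S : comNzRingType) (a b : S) :
  (a * b)%:MP = a%:MP * b%:MP :> {malg S[K]}.
Proof. by rewrite mul_malgC; apply/malgP => m; rewrite mcoeffZ !mcoeffC mulrnAr. Qed.

Section Series.
Variables (k : finFieldType) (C : fieldType).
Variables (iota : {rmorphism {fraction {poly k}} -> C}) (r : nat).

(* The index (j, m) stands for the indeterminate tau^m(X_j). *)
Definition Bring : Type := {malg C[{cmonom ('I_r * nat)%type}]}.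
HB.instance Definition _ := GRing.ComAlgebra.on Bring.

Definition tauX (j : 'I_r) (m : nat) : Bring := << ucm (j, m) >>.

Definition tau_mon (m : {cmonom ('I_r * nat)%type}) : Bring :=
  \prod_(x <- finsupp m) tauX x.1 x.2.+1 ^+ m x.

Definition tauB : Bring -> Bring := mmap (fun c => (c ^+ #|k|)%:MP) tau_mon.

Fact tau_mon_is_multiplicative : mmorphism tau_mon.
Proof.
have tau_monE (d : {fset 'I_r * nat}) (m : {cmonom ('I_r * nat)%type}) :
    (finsupp m `<=` d)%fset ->
  tau_mon m = \prod_(x <- d) tauX x.1 x.2.+1 ^+ m x.
  move=> sd; rewrite /tau_mon (big_fset_incl _ sd) //= => x _.
  by rewrite -cmE_eq0 => /eqP ->; rewrite expr0.
split=> [m1 m2|]; last by rewrite /tau_mon mdom1 big_seq_fset0.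
rewrite (tau_monE _ m1 (fsubsetUl _ (finsupp m2))).
rewrite (tau_monE _ m2 (fsubsetUr (finsupp m1) _)).
rewrite /tau_mon mdomD -big_split /=.
by apply: eq_bigr => x _; rewrite cmM exprD.
Qed.
HB.instance Definition _ :=
  isMultiplicative.Build _ Bring tau_mon tau_mon_is_multiplicative.

Fact tauB_rmorphism : exists phi : {rmorphism Bring -> Bring},
  [/\ phi =1 tauB, forall c, tauB c%:MP = (c ^+ #|k|)%:MP
    & forall j m, tauB (tauX j m) = tauX j m.+1].
Proof.
have [p p_pr pk] := finPcharP k.
have pC : p \in [pchar C].
  have := pcharf0 pk => /(congr1 (fun c : k => iota c%:P%:F)).
  by rewrite polyC0 polyC_natr !rmorph_nat !rmorph0 inE p_pr => ->; rewrite eqxx.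
have qC : [pchar C].-nat #|k|.
  by rewrite (card_pprimeChar pk) (eq_pnat _ (pcharf_eq pC)) pnatX pnat_id.
pose f (c : C) : Bring := (c ^+ #|k|)%:MP.
have fB : zmod_morphism f.
  by move=> a b; rewrite /f exprDn_pchar // exprNn_pchar // raddfB.
have fM : monoid_morphism f.
  split=> [|a b]; rewrite /f; first by rewrite expr1n mpolyC1E.
  by rewrite exprMn; exact: malgCM.
pose fr : {rmorphism C -> Bring} := HB.pack f
  (GRing.isZmodMorphism.Build _ _ f fB) (GRing.isMonoidMorphism.Build _ _ f fM).
exists (mmap fr tau_mon); split; [by []|move=> c|move=> j m].
  exact: (mmapC (f := fr) (h := tau_mon)).
rewrite /tauB /tauX -[LHS]/(mmap fr tau_mon _) [LHS]mmapU.
rewrite /= /f expr1n mpolyC1E mul1r.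
by rewrite /tau_mon mdomU big_seq_fset1 cmUU expr1.
Qed.

(* A_r : the series \sum_i f_i tau^i(Z) is the function i |-> f_i. *)
Definition Aring : Type := nat -> Bring.

Definition tauA (f : Aring) : Aring :=
  fun i => if i is i'.+1 then tauB (f i') else 0.

(* tau^i(f) has no term in tau^n(Z) for n < i (tauA_iter_lt below), whence the
   bound on i. *)
Definition expC (f : Aring) : Aring :=
  fun n => \sum_(i < n.+1) (iota (carlitz_D k i)%:F)^-1 *: iter i tauA f n.

Definition carlitz_at (a : {poly k}) (j : 'I_r) : Bring :=
  \sum_(i < size (carlitz a)) iota ((carlitz a)`_i)%:F *: tauX j i.

(* {poly_(d.+1) k} is the finite type of polynomials of degree at most d. *)
Definition calL : Aring :=
  fun d => \sum_(a : {poly_(d.+1) k} | (size a == d.+1) && (polyn a \is monic))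
    (iota (polyn a)%:F)^-1 *: \prod_(j < r) carlitz_at a j.

Definition calS : Aring := expC calL.

(* A[tau^m(X_j)] *)
Definition in_AX (b : Bring) : Prop :=
  forall m, exists a : {poly k}, b@_m = iota a%:F.

(* A[X_j, tau(X_j), ..., Z, tau(Z), ...] *)
Definition in_AXZ (f : Aring) : Prop :=
  (forall i, in_AX (f i)) /\ exists N : nat, forall i, (N <= i)%N -> f i = 0.

Lemma tauA_iter_lt (f : Aring) i n : (n < i)%N -> iter i tauA f n = 0.
Proof.
elim: i n => [//|i IH] [|n] //= lt_ni.
by rewrite IH // /tauB /mmap msupp0 big_seq_fset0.
Qed.

End Series.

(* Main.v *)
Require Import Defs.
From HB Require Import structures.
From mathcomp Require Import all_boot all_order all_algebra reals.
From mathcomp Require Import finmap finfield qpoly qfpoly boolp.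
From mathcomp Require Import ring zify.
From mathcomp.multinomials Require Import monalg.

Set Implicit Arguments.
Unset Strict Implicit.
Unset Printing Implicit Defensive.

Import Order.TTheory GRing.Theory Num.Theory.
Local Open Scope ring_scope.

(* Send t_1^(n_1) ... t_r^(n_r) to the product of the C_(theta^(n_j))(X_j).  This linear map
   from C_infty[t_1, ..., t_r] to B_r takes the product of the a(t_j) to that of the C_a(X_j),
   and turns tau into tau_phi = (t_1 - theta) ... (t_r - theta) tau, where tau fixes the t_j.
   Hence S_r is the image of exp(L) = sum_n v_n z^n, where L is the sum over the monic a of
   a(t_1) ... a(t_r) a^(-1) z^(deg a) and exp is built with tau_phi.

   Integrality: let P be a monic prime of degree d, and L' the part of L where a is prime
   to P.  As P L = P L' + P(t_1) ... P(t_r) z^d L, the functional equation of exp gives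
     C_P(exp L) - P(t_1) ... P(t_r) z^d exp L = exp(P L') = 0 mod P,
   while C_P = tau_phi^d and P(t) = (t - theta) ... (t - theta^(q^(d-1))) mod P.  Comparing
   coefficients of z^n shows by induction on n that v_n is P-integral.

   Vanishing: the Gauss norm of v_n is at most the maximum over i <= n of
   q^(r (1 + q + ... + q^(i-1)) - n q^i), which is < 1 for n > r, whereas |a| >= 1 for every
   nonzero a in A. *)

(** * Linear maps given by the images of the powers of the variable *)

Section LinearCombination.
Variables (S : nzRingType) (F : fieldType) (V : lmodType F) (g : {rmorphism S -> F}).
Variable u : nat -> V.

(** Coefficients pass through [g], so that one construction serves both for coefficients in A and,
    with [g] the identity, for coefficients already in the field. *)
Definition lincomb (h : {poly S}) : V := \sum_(i < size h) g h`_i *: u i.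

Lemma lincomb_widen N (h : {poly S}) : (size h <= N)%N ->
  lincomb h = \sum_(i < N) g h`_i *: u i.
Proof.
move=> hN; rewrite /lincomb (big_ord_widen N (fun i => g h`_i *: u i) hN).
rewrite big_mkcond; apply: eq_bigr => i _; case: ltnP => // /(nth_default 0) ->.
by rewrite rmorph0 scale0r.
Qed.

Fact lincomb_is_zmod_morphism : zmod_morphism lincomb.
Proof.
move=> h h'; set N := maxn (size h) (size h').
have hN : (size (h - h')%R <= N)%N by rewrite (leq_trans (size_polyD _ _)) ?size_polyN.
rewrite !(@lincomb_widen N) ?leq_maxl ?leq_maxr // -sumrB; apply: eq_bigr => i _.
by rewrite coefB rmorphB scalerBl.
Qed.
HB.instance Definition _ :=
  GRing.isZmodMorphism.Build _ _ lincomb lincomb_is_zmod_morphism.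

Lemma lincombZ c h : lincomb (c *: h) = g c *: lincomb h.
Proof.
rewrite (lincomb_widen (size_scale_leq c h)) scaler_sumr; apply: eq_bigr => i _.
by rewrite coefZ rmorphM scalerA.
Qed.

Lemma lincombXn n : lincomb 'X^n = u n.
Proof.
rewrite /lincomb size_polyXn big_ord_recr /= coefXn eqxx rmorph1 scale1r.
rewrite big1 ?add0r // => i _.
by rewrite coefXn ltn_eqF // rmorph0 scale0r.
Qed.

End LinearCombination.

(** * Carlitz polynomials modulo a prime *)

Section PrimePolynomials.
Variable k : finFieldType.
Local Notation q := #|k|.

Lemma card_finField_gt1 : (1 < q)%N.
Proof. exact: card_finNzRing_gt1. Qed.

Lemma expf_card_iter (x : k) i : x ^+ (q ^ i) = x.
Proof. by elim: i => [|i IH]; rewrite ?expr1 // expnS exprM expf_card IH. Qed.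

(** The morphism [f] gives [S] the characteristic of [k], of which q is a power. *)
Lemma pchar_card (S : comNzRingType) (f : {rmorphism k -> S}) : [pchar S].-nat q.
Proof.
have [p p_pr pk] := finPcharP k.
have pS : p \in [pchar S] by rewrite (rmorph_pchar f).
by rewrite (card_pprimeChar pk) (eq_pnat _ (pcharf_eq pS)) pnatX pnat_id.
Qed.

Lemma natr_card (S : comNzRingType) (f : {rmorphism k -> S}) : q%:R = 0 :> S.
Proof.
have [p p_pr pk] := finPcharP k.
have pS : p \in [pchar S] by rewrite (rmorph_pchar f).
have qq := card_pprimeChar pk; have := card_finField_gt1.
rewrite qq natrX (pcharf0 pS) expr0n; by case: logn.
Qed.

Lemma frobenius_card_iter (S : comNzRingType) (f : {rmorphism k -> S}) i (x y : S) :
  (x + y) ^+ (q ^ i) = x ^+ (q ^ i) + y ^+ (q ^ i).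
Proof. by rewrite exprDn_pchar // pnatX (pchar_card f). Qed.

(** The Frobenius is additive and fixes the coefficients, which lie in k. *)
Lemma poly_exp_card (f : {poly k}) i : f ^+ (q ^ i) = f \Po 'X ^+ (q ^ i).
Proof.
elim/poly_ind: f => [|f c IH].
  by rewrite comp_poly0 expr0n eqn0Ngt expn_gt0 (ltnW card_finField_gt1).
rewrite (frobenius_card_iter polyC) exprMn IH -polyC_exp expf_card_iter.
by rewrite comp_polyD comp_polyM comp_polyX comp_polyC.
Qed.

(** The outer variable is t, the inner one theta. This product plays two roles: modulo a prime of
    degree d its roots are the conjugates of theta, and its values at the t_j multiply to the factor
    in front of tau^d in tau_phi^d. *)
Definition prod_conj d : {poly {poly k}} := \prod_(i < d) ('X - ('X ^+ (q ^ i))%:P).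

Lemma prod_conjS d :
  prod_conj d.+1 = ('X - 'X%:P) * map_poly (comp_poly ('X ^+ q)) (prod_conj d).
Proof.
rewrite /prod_conj big_ord_recl expr1 rmorph_prod; congr (_ * _); apply: eq_bigr => i _.
by rewrite rmorphB /= map_polyX map_polyC /= comp_Xn_poly -exprM -expnS.
Qed.

Section Prime.
Variables (P : {poly k}) (PI : monic_irreducible_poly P).
Local Notation Q := {poly %/ P with PI}.
Local Notation d := (size P).-1.

Let red : {poly k} -> Q := in_qpoly P.
Let redB : zmod_morphism red. Proof. exact: (raddfB (in_qpoly P)). Qed.
Let redM : monoid_morphism red.
Proof. split; [exact: (rmorph1 (in_qpoly P))|exact: (rmorphM (in_qpoly P))]. Qed.
HB.instance Definition _ := GRing.isZmodMorphism.Build _ _ red redB.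
HB.instance Definition _ := GRing.isMonoidMorphism.Build _ _ red redM.

Lemma red_eq0 f : (red f == 0) = (P %| f).
Proof.
by rewrite -val_eqE /= /red /in_qpoly /= mk_monicE // /dvdp Pdiv.IdomainMonic.modpE ?PI.
Qed.

Lemma red_onto (y : Q) : exists f, y = red f.
Proof.
exists (y : {poly %/ P}); apply: val_inj; rewrite /= Pdiv.CommonRing.rmodp_small //.
exact: size_mk_monic.
Qed.

Lemma dvdp_exp_card_sub (f : {poly k}) : P %| f ^+ (q ^ d) - f.
Proof. by rewrite -red_eq0 rmorphB rmorphXn /= -(card_qfpoly PI) expf_card subrr. Qed.

(** Otherwise theta, and with it every polynomial in theta, would be a root of Y^(q^i) - Y in A/P:
    that is q^d roots for a degree of only q^i. *)
Lemma Ndvdp_X_exp_card i : (0 < i < d)%N -> ~~ (P %| 'X ^+ (q ^ i) - 'X).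
Proof.
move=> /andP[i0 id]; apply/negP; rewrite -red_eq0 => /eqP h.
have qi1 : (1 < q ^ i)%N by rewrite -{1}(exp1n i) ltn_exp2r // card_finField_gt1.
pose p : {poly Q} := 'X ^+ (q ^ i) - 'X.
have sp : size p = (q ^ i).+1.
  by rewrite size_polyDl ?size_polyXn // size_polyN size_polyX.
have /max_poly_roots : p != 0 by rewrite -size_poly_eq0 sp.
move/(_ (enum Q)); rewrite enum_uniq -cardE card_qfpoly sp.
have -> : all (root p) (enum Q).
  apply/allP => y _; have [f ->] := red_onto y.
  rewrite rootE !hornerE subr_eq0 -rmorphXn poly_exp_card.
  have /eqP := h; rewrite rmorphB rmorphXn /= subr_eq0 => /eqP h'.
  rewrite -subr_eq0 -rmorphB; apply/eqP.
  elim/poly_ind: f => [|f c IH]; first by rewrite comp_poly0 subrr rmorph0.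
  rewrite comp_polyD comp_polyM comp_polyX comp_polyC opprD addrACA subrr addr0.
  move: IH; rewrite !rmorphB !rmorphM rmorphXn /= h'.
  by move/eqP; rewrite subr_eq0 => /eqP ->; rewrite subrr.
move/(_ isT isT); rewrite ltnS leq_exp2l ?card_finField_gt1 //.
by rewrite leqNgt id.
Qed.

(** Modulo P, the theta^(q^i) with i < d are d distinct roots of the monic polynomial P(t) of degree
    d, so P(t) is the product of the corresponding linear factors. *)
Lemma prime_prod_frobenius : exists g : {poly {poly k}},
  map_poly polyC P = prod_conj d + P *: g.
Proof.
have [[P1 _] Pm] := PI.
pose h : {poly {poly k}} := map_poly polyC P - prod_conj d.
suff hP n : P %| h`_n.
  exists (\poly_(n < size h) (h`_n %/ P)).
  rewrite -[LHS](subrK (prod_conj d)) addrC; congr (_ + _).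
  rewrite -/h; apply/polyP => n; rewrite coefZ coef_poly.
  case: ltnP => [_|/(nth_default 0) ->]; last by rewrite mulr0.
  by rewrite mulrC divpK.
rewrite -red_eq0 -coef_map; suff -> : map_poly red h = 0 by rewrite coef0.
rewrite rmorphB /prod_conj rmorph_prod /=; apply/eqP; rewrite subr_eq0; apply/eqP.
pose x : Q := red 'X.
rewrite -map_poly_comp.
pose rs := [seq x ^+ (q ^ i) | i <- index_iota 0 d].
have -> : \prod_(i < d) map_poly red ('X - ('X ^+ (q ^ i))%:P) = \prod_(z <- rs) ('X - z%:P).
  rewrite big_map big_mkord; apply: eq_bigr => i _.
  by rewrite rmorphB /= map_polyX map_polyC /= (rmorphXn red).
have Pc : map_poly (red \o polyC) P \is monic by rewrite map_monic.
rewrite [LHS](@all_roots_prod_XsubC _ _ rs) ?(monicP Pc) ?scale1r //.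
- by rewrite size_map_poly size_map size_iota subn0 prednK // (ltnW P1).
- apply/allP => _ /mapP[i _ ->]; rewrite rootE -rmorphXn.
  have -> : (map_poly (red \o polyC) P).[red ('X ^+ (q ^ i))] = red (P ^+ (q ^ i)).
    by rewrite [in RHS]poly_exp_card /comp_poly -(horner_map red) -map_poly_comp.
  by rewrite red_eq0 dvdp_exp // expn_gt0 (ltnW card_finField_gt1).
(* If x^(q^i) = x^(q^j) with i < j, then x^(q^(j-i)) - x has q^i-th power 0, hence is 0 in the field
   A/P, against [Ndvdp_X_exp_card]. *)
- rewrite uniq_rootsE map_inj_in_uniq ?iota_uniq //.
  move=> i j; rewrite !mem_index_iota /=.
  wlog: i j / (i <= j)%N.
    by move=> W; case: (leqP i j) => [/W//|/ltnW /W W'] hi hj e; rewrite (W' hj hi).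
  move=> ij hi hj e; apply/eqP; rewrite eqn_leq ij leqNgt; apply/negP => lij.
  have : ~~ (P %| 'X ^+ (q ^ (j - i)) - 'X).
    by apply: Ndvdp_X_exp_card; rewrite subn_gt0 lij (leq_ltn_trans (leq_subr _ _)).
  rewrite -red_eq0 rmorphB rmorphXn /= -/x; case/negP.
  have : (x ^+ (q ^ (j - i)) - x) ^+ (q ^ i) == 0.
    have := frobenius_card_iter (red \o polyC) i (x ^+ (q ^ (j - i)) - x) x.
    rewrite subrK => /eqP; rewrite -exprM -expnD subnK // -e.
    by rewrite -subr_eq subrr eq_sym.
  by rewrite expf_eq0 => /andP[].
Qed.

End Prime.

(** The derivative of theta^(q^i) - theta is -1, while a square factor P^2 would make P divide
    it. *)
Lemma sqr_Ndvdp_X_exp_card (P : {poly k}) i :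
  irreducible_poly P -> (0 < i)%N -> ~~ (P ^+ 2 %| 'X ^+ (q ^ i) - 'X).
Proof.
move=> [P1 _] i0; apply/negP => /dvdpP[f e].
have := congr1 deriv e; rewrite derivB derivX derivXn derivM expr2 derivM.
rewrite -[i in LHS]prednK // expnS mulrnA -[_ *+ q]mulr_natr.
rewrite (natr_card polyC) mulr0 mul0rn sub0r => h.
have : P %| -1.
  rewrite h; apply: dvdp_add; first by rewrite mulrA dvdp_mull.
  by apply/dvdp_mull/dvdp_add; [exact: dvdp_mull|exact: dvdp_mulr].
by rewrite -scaleN1r dvdpZr ?oppr_eq0 ?oner_eq0 // dvdp1; case: size P1 => [|[]].
Qed.

Lemma carlitz_D_neq0 i : carlitz_D k i != 0.
Proof.
elim: i => [|i IH] /=; first exact: oner_neq0.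
rewrite mulf_neq0 ?expf_neq0 // subr_eq0.
apply/eqP => /(congr1 (fun p : {poly k} => size p)); rewrite size_polyXn size_polyX.
have := ltn_expl i.+1 card_finField_gt1.
by case: (q ^ i.+1)%N => [|[|]].
Qed.

(* The P-adic valuation of D_i is at most q^i - 1, as the theta^(q^i) - theta are squarefree. *)
Lemma carlitz_D_valuation (P : {poly k}) i : irreducible_poly P ->
  exists a b, ~~ (P %| b) /\ P ^+ (q ^ i).-1 * b = a * carlitz_D k i.
Proof.
move=> PI; have q1 := card_finField_gt1.
elim: i => [|i [a [b [Pb e]]]].
  by exists 1, 1; split; rewrite // dvdp1; have [] := PI; case: size => [|[]].
set m : {poly k} := 'X ^+ (q ^ i.+1) - 'X.
(* As P divides [m] at most once, either [c] = 1 and [u] = m / P, or [c] = P and [u] = m. *)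
have [c [u [Pu eu]]] : exists c u, ~~ (P %| u) /\ P * u = c * m.
  have [/dvdpP[u mu]|Pm] := boolP (P %| m); last by exists P, m.
  exists 1, u; split; last by rewrite mul1r mu mulrC.
  apply/negP => /dvdpP[v uv]; have /negP[] := sqr_Ndvdp_X_exp_card PI (ltn0Sn i).
  by rewrite -/m mu uv -mulrA -expr2 dvdp_mull.
(* The exponent splits as q^(i+1) - 1 = q (q^i - 1) + 1 + (q - 2): the first part comes from D_i^q,
   the 1 from [m], and the rest is surplus. *)
exists (a ^+ q * c * P ^+ q.-2), (b ^+ q * u); split.
  move: Pb Pu; rewrite -!irreducible_poly_coprime // => Pb Pu.
  by rewrite coprimepMr coprimep_expr.
have -> : (q ^ i.+1).-1 = ((q ^ i).-1 * q + 1 + q.-2)%N.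
  rewrite expnSr; have : (0 < q ^ i)%N by rewrite expn_gt0 (ltnW q1).
  case: (q ^ i)%N => [//|n] _; move: q1; case: q => [|[|x]] // _.
  by rewrite mulSn /= addnC addn1 addSn addnS.
rewrite !exprD expr1 exprM /= -/m -[RHS]mulrA.
transitivity ((P ^+ (q ^ i).-1 * b) ^+ q * (P * u) * P ^+ q.-2).
  by rewrite exprMn; set x := _ ^+ q; ring.
by rewrite e eu exprMn; set x := _ ^+ q; set y := _ ^+ q; ring.
Qed.

End PrimePolynomials.

(** * The functional equation of the exponential *)

Section TwistedExponential.
Variables (k : finFieldType) (F : fieldType) (iA : {rmorphism {poly k} -> F}).
Hypothesis iA_inj : injective iA.
Variables (T : comAlgType F) (tau : {rmorphism T -> T}) (om : T).
Local Notation q := #|k|.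
Hypothesis tauZ : forall c f, tau (c *: f) = c ^+ q *: tau f.
Implicit Types (f e : nat -> T) (h : {poly {poly k}}).

Definition tphi (x : T) := om * tau x.

Definition expT f n :=
  \sum_(i < n.+1) (iA (carlitz_D k i))^-1 *: iter i tphi (f (n - i)%N).

(* A sequence e stands for the series sum_n e_n z^n, on which tau raises the
   degree in z by one: shift is tau, Theta is C_theta = theta + tau, and act h is the result
   of substituting Theta for the variable t of h in A[t]. *)
Definition shift e n := if n is m.+1 then tphi (e m) else 0.

Definition Theta e n := iA 'X *: e n + shift e n.

Definition act h e n := lincomb iA (fun m => iter m Theta e n) h.

Lemma tphi_is_additive : zmod_morphism tphi.
Proof. by move=> x y; rewrite /tphi rmorphB mulrBr. Qed.
HB.instance Definition _ := GRing.isZmodMorphism.Build _ _ tphi tphi_is_additive.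

Lemma tphiZ c x : tphi (c *: x) = c ^+ q *: tphi x.
Proof. by rewrite /tphi tauZ scalerAr. Qed.

Lemma iter_tphiD i x y : iter i tphi (x + y) = iter i tphi x + iter i tphi y.
Proof. by elim: i => //= i ->; rewrite raddfD. Qed.

Lemma iter_tphi0 i : iter i tphi 0 = 0.
Proof. by elim: i => //= i ->; rewrite raddf0. Qed.

Lemma iter_tphiZ i c x : iter i tphi (c *: x) = c ^+ (q ^ i) *: iter i tphi x.
Proof. by elim: i => //= i ->; rewrite tphiZ -exprM -expnSr. Qed.

Lemma expT_ext f f' : f =1 f' -> expT f =1 expT f'.
Proof. by move=> ff n; apply: eq_bigr => i _; rewrite ff. Qed.

Lemma expTD f f' n : expT (fun m => f m + f' m) n = expT f n + expT f' n.
Proof. by rewrite -big_split; apply: eq_bigr => i _; rewrite iter_tphiD scalerDr. Qed.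

Lemma expT_const (c : k) f n :
  expT (fun m => iA c%:P *: f m) n = iA c%:P *: expT f n.
Proof.
rewrite scaler_sumr; apply: eq_bigr => i _.
by rewrite iter_tphiZ -rmorphXn -polyC_exp expf_card_iter !scalerA mulrC.
Qed.

(** Coefficientwise this is theta^(q^i) / D_i = theta / D_i + 1 / D_(i-1)^q, the recursion defining
    D_i. *)
Lemma expT_theta f n : expT (fun m => iA 'X *: f m) n = Theta (expT f) n.
Proof.
rewrite /Theta /shift /expT big_ord_recl [in RHS]big_ord_recl scalerDr -addrA; congr (_ + _).
  by rewrite /= rmorph1 invr1 !scale1r.
case: n => [|n]; first by rewrite !big_ord0 scaler0 addr0.
rewrite scaler_sumr raddf_sum -big_split; apply: eq_bigr => i _ /=.
rewrite tphiZ iter_tphiZ tphiZ -exprM -expnSr subSS !scalerA -scalerDl; congr (_ *: _).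
have u0 : iA ('X ^+ (q ^ i.+1) - 'X) * iA (carlitz_D k i) ^+ q != 0.
  have := carlitz_D_neq0 k i.+1.
  by rewrite /= -(inj_eq iA_inj) rmorph0 rmorphM (rmorphXn iA q).
rewrite rmorphM (rmorphXn iA q).
apply: (mulfI u0); rewrite mulrA mulfV // mul1r mulrDr mulrCA mulfV // mulr1.
rewrite exprVn mulfK; last by move: u0; rewrite mulf_eq0 => /norP[].
by rewrite addrC -rmorphD subrK rmorphXn.
Qed.

Lemma Theta_ext e e' : e =1 e' -> Theta e =1 Theta e'.
Proof. by move=> ee [|n]; rewrite /Theta /shift !ee. Qed.

Lemma act_ext h e e' : e =1 e' -> act h e =1 act h e'.
Proof.
move=> ee n; apply: eq_bigr => m _; congr (_ *: _).
elim: (val m) n => [|i IH] n /=; [exact: ee|exact: Theta_ext].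
Qed.

Lemma act_widen N h e n : (size h <= N)%N ->
  act h e n = \sum_(m < N) iA h`_m *: iter m Theta e n.
Proof. exact: lincomb_widen. Qed.

Lemma act_MXaddC h c e n :
  act (h * 'X + c%:P) e n = iA c *: e n + act h (Theta e) n.
Proof.
rewrite (@act_widen (size h).+1); last by rewrite size_MXaddC; case: ifP.
rewrite big_ord_recl coefD coefMX coefC add0r; congr (_ + _).
by apply: eq_bigr => m _; rewrite coefD coefMX coefC /= addr0 -iterSr.
Qed.

Lemma actD h h' e n : act (h + h') e n = act h e n + act h' e n.
Proof. exact: raddfD. Qed.

Lemma actZ a h e n : act (a *: h) e n = iA a *: act h e n.
Proof. exact: lincombZ. Qed.

(** The functional equation of exp for C_a, obtained from the case of theta and k-linearity by
    Horner induction on a. *)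
Lemma expT_act (a : {poly k}) f n :
  expT (fun m => iA a *: f m) n = act (map_poly polyC a) (expT f) n.
Proof.
elim/poly_ind: a f n => [|a c IH] f n.
  rewrite map_poly0 (@act_widen 0%N) ?size_poly0 // big_ord0 /expT big1 // => i _.
  by rewrite rmorph0 scale0r iter_tphi0 scaler0.
have -> : map_poly polyC (a * 'X + c%:P) = map_poly polyC a * 'X + c%:P%:P.
  by rewrite rmorphD rmorphM /= map_polyX map_polyC.
rewrite act_MXaddC -expT_const.
rewrite -(act_ext _ (expT_theta f)) -IH addrC -expTD.
by apply: expT_ext => m; rewrite rmorphD rmorphM scalerDl scalerA.
Qed.

(* Multiplication by (t - theta) tau on A[t] is left multiplication by tau on
   A{tau} when t acts as the Carlitz operator C_theta = theta + tau. *)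
Lemma act_Frobenius h e n :
  act (('X - 'X%:P) * map_poly (comp_poly ('X ^+ q)) h) e n = shift (act h e) n.
Proof.
set h' := map_poly _ h.
have sh' : (size h' <= size h)%N by exact: size_poly.
have hX : act ('X * h') e n = \sum_(m < size h) iA h'`_m *: iter m.+1 Theta e n.
  rewrite (@act_widen (size h).+1); last first.
    by rewrite mulrC (leq_trans (size_polyMleq _ _)) // size_polyX addn2.
  rewrite big_ord_recl coefXM rmorph0 scale0r add0r.
  by apply: eq_bigr => m _; rewrite coefXM.
have -> : ('X - 'X%:P) * h' = 'X * h' + (- 'X) *: h'.
  by rewrite mulrBl mul_polyC scaleNr.
rewrite actD actZ hX (act_widen _ _ sh') scaler_sumr -big_split /=.
(* Since Theta is theta plus [shift], the factor t - theta turns [iter m Theta e] into its shift;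
   semilinearity of tau then absorbs the q-th powers of the coefficients. *)
transitivity (\sum_(m < size h) iA (h`_m ^+ q) *: shift (iter m Theta e) n).
  apply: eq_bigr => m _; rewrite coef_map /=.
  have -> : h`_m \Po 'X ^+ q = h`_m ^+ q by rewrite -[in RHS](expn1 q) poly_exp_card expn1.
  by rewrite /Theta scalerDr rmorphN !scalerA mulNr mulrC scaleNr addrAC subrr add0r.
case: n {hX} => [|n] /=; first by rewrite big1 // => m _; rewrite scaler0.
by rewrite (raddf_sum tphi); apply: eq_bigr => m _; rewrite /= tphiZ rmorphXn.
Qed.

Lemma shift_ext e e' : e =1 e' -> shift e =1 shift e'.
Proof. by move=> ee [|n]; rewrite /shift ?ee. Qed.

(** Each factor split off by [prod_conjS] contributes one tau. Applied to P(t) = [prod_conj d] + P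
    g, this gives C_P = tau_phi^d + P g(C_theta). *)
Lemma act_prod_conj d e n :
  act (prod_conj k d) e n = iter d shift e n.
Proof.
elim: d n => [|d IH] n.
  by rewrite /prod_conj big_ord0 -(expr0 'X) /act lincombXn.
by rewrite prod_conjS act_Frobenius /= (shift_ext IH).
Qed.

Lemma iter_shift d e n :
  iter d shift e n = if (d <= n)%N then iter d tphi (e (n - d)%N) else 0.
Proof.
elim: d n => [|d IH] n /=; first by rewrite subn0.
by case: n => [|n] //=; rewrite IH ltnS subSS; case: ifP; rewrite ?raddf0.
Qed.

Section Integrality.
Variable S : {pred T}.
Hypotheses (S0 : 0 \in S) (SD : {in S &, forall x y, x + y \in S}).
Hypotheses (SZ : forall a x, x \in S -> iA a *: x \in S).
Hypothesis (Stphi : forall x, x \in S -> tphi x \in S).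

(** Theta differs from multiplication by theta only by [shift], which at n sees only earlier terms.
    So modulo [S] the operator g(Theta) acts on [e n] as the scalar g(theta), with nothing assumed
    on [e n] itself. *)
Lemma act_sub_eval g e n : (forall m, (m < n)%N -> e m \in S) ->
  act g e n - iA g.['X] *: e n \in S.
Proof.
elim/poly_ind: g e => [|g c IH] e eS.
  by rewrite /act raddf0 horner0 rmorph0 scale0r subrr.
have -> : act (g * 'X + c%:P) e n - iA (g * 'X + c%:P).['X] *: e n =
    (act g (Theta e) n - iA g.['X] *: Theta e n) + iA g.['X] *: shift e n.
  rewrite act_MXaddC hornerMXaddC rmorphD rmorphM scalerDl /Theta scalerDr scalerA.
  by rewrite !opprD !addrA subrK [LHS]addrC !addrA addNr add0r.
have shS m : (m <= n)%N -> shift e m \in S.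
  by case: m => [//|m mn]; rewrite Stphi ?eS.
by rewrite SD ?SZ ?shS ?IH // => m mn; rewrite SD ?SZ ?eS ?shS // ltnW.
Qed.
End Integrality.

End TwistedExponential.

(** * The q-power Frobenius of the coefficient field *)

Section Frobenius.
Variables (k : finFieldType) (F : fieldType) (iA : {rmorphism {poly k} -> F}).
Local Notation q := #|k|.

(* The morphism from {poly k} only witnesses that F has the characteristic of k. *)
Definition frobF of {rmorphism {poly k} -> F} := fun c : F => c ^+ q.
Local Notation frob := (frobF iA).

Fact frobF_is_zmod_morphism : zmod_morphism frob.
Proof.
have qF : [pchar F].-nat q by exact: (pchar_card (iA \o polyC)).
by move=> a b; rewrite /frobF exprDn_pchar // exprNn_pchar.
Qed.
Fact frobF_is_monoid_morphism : monoid_morphism frob.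
Proof. by split=> [|a b]; rewrite /frobF ?expr1n // exprMn. Qed.
HB.instance Definition _ := GRing.isZmodMorphism.Build _ _ frob frobF_is_zmod_morphism.
HB.instance Definition _ := GRing.isMonoidMorphism.Build _ _ frob frobF_is_monoid_morphism.

End Frobenius.

(** * Integrality at a prime *)

Section Evaluation.
Variables (k : finFieldType) (F : fieldType) (iA : {rmorphism {poly k} -> F}).
Variables (T : comAlgType F) (tau : {rmorphism T -> T}) (r : nat) (tv : 'I_r -> T).
Local Notation q := #|k|.
Hypothesis tauZ : forall c f, tau (c *: f) = c ^+ q *: tau f.
Hypothesis tau_tv : forall j, tau (tv j) = tv j.
Local Notation frob := (frobF iA).

Definition evalt (j : 'I_r) (h : {poly F}) : T := horner_alg (tv j) h.

Fact evalt_is_zmod_morphism j : zmod_morphism (evalt j).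
Proof. exact: raddfB. Qed.
Fact evalt_is_monoid_morphism j : monoid_morphism (evalt j).
Proof. split; [exact: rmorph1|exact: rmorphM]. Qed.
HB.instance Definition _ j :=
  GRing.isZmodMorphism.Build _ _ (evalt j) (evalt_is_zmod_morphism j).
HB.instance Definition _ j :=
  GRing.isMonoidMorphism.Build _ _ (evalt j) (evalt_is_monoid_morphism j).

Lemma evaltX j : evalt j 'X = tv j.
Proof. exact: horner_algX. Qed.

Lemma evaltC j c : evalt j c%:P = c%:A.
Proof. exact: horner_algC. Qed.

Lemma evaltZ j c h : evalt j (c *: h) = c *: evalt j h.
Proof. by rewrite -mul_polyC rmorphM /= evaltC mulr_algl. Qed.

Lemma evaltE j (h : {poly F}) :
  evalt j h = \sum_(i < size h) h`_i *: tv j ^+ i.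
Proof.
rewrite -{1}[h]coefK poly_def (raddf_sum (evalt j)); apply: eq_bigr => i _.
by rewrite /= evaltZ rmorphXn /= evaltX.
Qed.

Lemma tau_evalt j (h : {poly F}) : tau (evalt j h) = evalt j (map_poly frob h).
Proof.
elim/poly_ind: h => [|h c IH]; first by rewrite map_poly0 !rmorph0.
rewrite !rmorphD !rmorphM /= IH map_polyX map_polyC /= !evaltX !evaltC.
by rewrite tauZ tau_tv rmorph1.
Qed.

(** The product h(t_1) ... h(t_r), where the inner variable of [h] is theta. *)
Definition tprod (h : {poly {poly k}}) : T := \prod_j evalt j (map_poly iA h).

Lemma tprodM h h' : tprod (h * h') = tprod h * tprod h'.
Proof. by rewrite -big_split; apply: eq_bigr => j _; rewrite !rmorphM. Qed.

Lemma tau_tprod h : tau (tprod h) = tprod (map_poly (comp_poly ('X ^+ q)) h).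
Proof.
rewrite rmorph_prod; apply: eq_bigr => j _; rewrite tau_evalt -!map_poly_comp.
congr evalt; apply: eq_map_poly => a /=.
by rewrite /frobF -rmorphXn -{1}(expn1 q) poly_exp_card expn1.
Qed.

Lemma tau_tprod_const (a : {poly k}) :
  tau (tprod (map_poly polyC a)) = tprod (map_poly polyC a).
Proof.
rewrite tau_tprod -map_poly_comp; congr tprod.
by apply: eq_map_poly => c /=; rewrite comp_polyC.
Qed.

Definition tphit := tphi tau (tprod ('X - 'X%:P)).
HB.instance Definition _ :=
  GRing.isZmodMorphism.Build _ _ tphit (tphi_is_additive tau _).

Lemma iter_tphit d x : iter d tphit x = tprod (prod_conj k d) * iter d tau x.
Proof.
elim: d => [|d IH] /=.
  by rewrite /prod_conj big_ord0 /tprod big1 ?mul1r // => j _; rewrite !rmorph1.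
by rewrite IH /tphit /tphi rmorphM mulrA tau_tprod -tprodM prod_conjS.
Qed.

Lemma tphit_mul_const (a : {poly k}) x :
  tphit (tprod (map_poly polyC a) * x) = tprod (map_poly polyC a) * tphit x.
Proof. by rewrite /tphit /tphi rmorphM tau_tprod_const mulrCA. Qed.

Definition Lser (n : nat) : T :=
  \sum_(a : {poly_(n.+1) k} | (size a == n.+1) && (polyn a \is monic))
    (iA (polyn a))^-1 *: tprod (map_poly polyC (polyn a)).

Definition Lser_coprime (P : {poly k}) (n : nat) : T :=
  \sum_(a : {poly_(n.+1) k} | [&& size a == n.+1, polyn a \is monic & ~~ (P %| polyn a)])
    (iA (polyn a))^-1 *: tprod (map_poly polyC (polyn a)).

(** The monic multiples of P of degree n are the P b with b monic of degree n - d, and the factor P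
    cancels against the one in (P b)^(-1). *)
Lemma Lser_split (P : {poly k}) n (d := (size P).-1) :
  P \is monic -> (forall a, a != 0 -> iA a != 0) ->
  iA P *: Lser n = iA P *: Lser_coprime P n +
    if (d <= n)%N then tprod (map_poly polyC P) * Lser (n - d) else 0.
Proof.
move=> Pm iA0.
have P0 : P != 0 by rewrite monic_neq0.
have sP : size P = d.+1 by rewrite prednK // size_poly_gt0.
rewrite /Lser (bigID (fun a : {poly_(n.+1) k} => P %| polyn a)) /= scalerDr addrC.
congr (_ + _); first by congr (_ *: _); apply: eq_bigl => a; rewrite andbA.
case: leqP => dn; last first.
  rewrite big1 ?scaler0 // => a /andP[/andP[/eqP sa _] Pa].
  have : (size P <= size (polyn a))%N by rewrite dvdp_leq // -size_poly_eq0 sa.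
  by rewrite sa sP ltnS leqNgt dn.
(* The bijection is b |-> P b, with inverse a |-> a / P. The bounds [sq] and [sz] ensure that
   [npolyp] leaves these polynomials unchanged. *)
rewrite (reindex_onto (fun b : {poly_((n - d).+1) k} => npolyp n.+1 (P * polyn b))
   (fun a => npolyp (n - d).+1 (polyn a %/ P))) /=; last first.
  move=> a /andP[/andP[/eqP sa am] Pa]; apply: val_inj => /=.
  have sq : (size (polyn a %/ P)%R <= (n - d).+1)%N.
    by rewrite size_divp // sa subSn.
  by rewrite (npolypK sq) mulrC divpK // npolypK ?sa.
rewrite scaler_sumr mulr_sumr.
have sz (b : {poly_((n - d).+1) k}) : (size (P * polyn b)%R <= n.+1)%N.
  rewrite (leq_trans (size_polyMleq _ _)) // sP addSn.
  by rewrite (leq_trans (leq_add (leqnn d) (size_npoly b))) // addnS subnKC.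
apply: eq_big => [b|b _].
  rewrite npolypK // monicMl // dvdp_mulr // andbT.
  have -> : npolyp (n - d).+1 ((P * polyn b) %/ P) = b.
    by apply: val_inj; rewrite /= mulKp // npolypK // size_npoly.
  rewrite eqxx andbT; have [bm|] := boolP (polyn b \is monic); rewrite ?andbT ?andbF //.
  rewrite size_monicM // ?monic_neq0 // sP addSn /=.
  by rewrite -(eqn_add2l d (size _)) addnS (subnKC dn).
rewrite npolypK // !rmorphM /= tprodM invfM scalerA mulrA mulfV ?iA0 // mul1r.
by rewrite scalerAr.
Qed.

Local Notation L := Lser.
Local Notation expt := (expT iA tau (tprod ('X - 'X%:P))).

(** exp commutes with multiplication by a(t_1) ... a(t_r) z^d, because tau fixes the t_j and the
    elements of k. *)
Lemma expt_delay (a : {poly k}) d (f : nat -> T) n :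
  expt (fun m => if (d <= m)%N then tprod (map_poly polyC a) * f (m - d)%N else 0) n =
  if (d <= n)%N then tprod (map_poly polyC a) * expt f (n - d)%N else 0.
Proof.
have itm i x : iter i tphit (tprod (map_poly polyC a) * x) =
    tprod (map_poly polyC a) * iter i tphit x.
  by elim: i => //= i ->; rewrite tphit_mul_const.
rewrite /expT; case: leqP => [dn|nd]; last first.
  rewrite big1 // => i _; rewrite leqNgt (leq_ltn_trans (leq_subr _ _) nd) /=.
  by rewrite iter_tphi0 scaler0.
have le : ((n - d).+1 <= n.+1)%N by rewrite ltnS leq_subr.
rewrite (big_ord_widen _ (fun i => (iA (carlitz_D k i))^-1 *: iter i tphit (f (n - d - i)%N)) le).
rewrite [in RHS]big_mkcond mulr_sumr; apply: eq_bigr => i _ /=.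
have -> : (i < (n - d).+1)%N = (d <= n - i)%N.
  by rewrite ltnS !leq_subRL 1?addnC // -ltnS.
case: ifP => _; last by rewrite iter_tphi0 scaler0 mulr0.
by rewrite -scalerAr subnAC -itm.
Qed.

Section LocalIntegrality.
(** [W] stands for the P-integral elements, and [modP] for membership in P W. [Wfermat] reflects
    that the residue field A/P has q^d elements and that tau fixes the t_j. *)
Variables (P : {poly k}) (PI : monic_irreducible_poly P) (W : subringClosed T).
Hypothesis iA_inj : injective iA.
Hypothesis WZ : forall a x, x \in W -> iA a *: x \in W.
Hypothesis Wtv : forall j, tv j \in W.
Hypothesis Wtau : forall x, x \in W -> tau x \in W.
Hypothesis WV : forall a x, ~~ (P %| a) -> x \in W -> (iA a)^-1 *: x \in W.
Hypothesis Wfermat : forall x, x \in W ->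
  (iA P)^-1 *: (iter (size P).-1 tau x - x) \in W.
Local Notation d := (size P).-1.
Local Notation modP x := ((iA P)^-1 *: x \in W).

Let iA_neq0 a : a != 0 -> iA a != 0.
Proof. by rewrite -(inj_eq iA_inj) rmorph0. Qed.

Let iAP0 : iA P != 0.
Proof. by apply: iA_neq0; rewrite monic_neq0 ?PI. Qed.

Lemma evalt_mem j (h : {poly {poly k}}) : evalt j (map_poly iA h) \in W.
Proof.
rewrite evaltE rpred_sum // => i _; rewrite coef_map /= WZ //.
by rewrite rpredX.
Qed.

Lemma tprod_mem h : tprod h \in W.
Proof. by rewrite rpred_prod // => j _; rewrite evalt_mem. Qed.

Lemma tphit_mem x : x \in W -> tphit x \in W.
Proof. by move=> Wx; rewrite /tphit /tphi rpredM ?tprod_mem ?Wtau. Qed.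

Lemma iter_tphit_mem i x : x \in W -> iter i tphit x \in W.
Proof. by move=> Wx; elim: i => //= i IH; rewrite tphit_mem. Qed.

Lemma tprod_congr h g : modP (tprod (h + P *: g) - tprod h).
Proof.
(* Congruence modulo P is compatible with products only inside [W], so membership is carried
   along. *)
pose R (x y : T) := [/\ x \in W, y \in W & modP (x - y)].
suff [] : R (tprod (h + P *: g)) (tprod h) by [].
apply: big_rec2 => [|j x y _ [Wx Wy Wxy]].
  by split; rewrite ?rpred1 // subrr scaler0 rpred0.
have Wj := evalt_mem j; split; rewrite ?rpredM //.
set u := evalt j _; set v := evalt j _.
have -> : u * x - v * y = u * (x - y) + (u - v) * y by ring.
rewrite scalerDr scalerAr scalerAl rpredD // rpredM //; first exact: Wj.
rewrite /u /v !rmorphD addrAC subrr add0r.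
rewrite /= map_polyZ /= evaltZ scalerA mulVf // scale1r; exact: Wj.
Qed.

(** D_i has P-valuation at most q^i - 1, so P^(q^i) / D_i is still divisible by P. This makes exp(P
    L') vanish modulo P, as tau_phi^i turns the factor P into P^(q^i). *)
Lemma carlitz_D_mem i x :
  x \in W -> modP ((iA (carlitz_D k i))^-1 *: (iA P ^+ (q ^ i) *: x)).
Proof.
move=> Wx; have [a [b [Pb e]]] := carlitz_D_valuation i PI.1.
have D0 : iA (carlitz_D k i) != 0 by rewrite iA_neq0 ?carlitz_D_neq0.
have b0 : iA b != 0 by rewrite iA_neq0 //; apply: contraNneq Pb => ->; rewrite dvdp0.
rewrite !scalerA; set c := _ * _; suff -> : c = (iA b)^-1 * iA a.
  by rewrite -scalerA WV ?WZ.
apply: (mulfI b0); rewrite [RHS]mulrA mulfV // mul1r; apply: (mulIf D0).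
rewrite -rmorphM -e rmorphM rmorphXn /= /c.
have : (0 < q ^ i)%N by rewrite expn_gt0 (ltnW (card_finField_gt1 k)).
by case: (q ^ i)%N => // m _; rewrite exprS /=; field; rewrite D0.
Qed.

(** Strong induction on n: the functional equation at P, divided by P, shows that the n-th term of
    g(C_theta)(exp L) is P-integral, and that term agrees with v_n up to earlier terms because
    g(theta) = 1. *)
Lemma expt_Lser_local n : expt L n \in W.
Proof.
have [m] := ubnP n; elim: m n => // m IH n; rewrite ltnS => nm.
have eW i : (i < n)%N -> expt L i \in W.
  by move=> i_n; apply: IH; apply: leq_trans nm.
have d0 : (0 < d)%N by case: PI => -[]; case: size => [|[]].
have [g Pg] := prime_prod_frobenius PI.
(* At t = theta the factor t - theta of [prod_conj] vanishes and P(t) becomes P, which leaves P = P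
   g(theta). *)
have g1 : g.['X] = 1.
  have := congr1 (horner^~ 'X) Pg; rewrite hornerD hornerZ /prod_conj.
  rewrite -(prednK d0) big_ord_recl hornerM expr1 hornerXsubC subrr mul0r add0r.
  have -> : (map_poly polyC P).['X] = P by rewrite -[RHS]comp_polyXr.
  move=> e; apply: (@mulfI _ P); first by rewrite monic_neq0 ?PI.
  by rewrite mulr1 -e.
(* C_P (exp L) - P(t_1) ... P(t_r) z^d exp L = exp (P L'), with C_P = tau_phi^d + P g(C_theta). *)
have main : iA P *: act iA tau (tprod ('X - 'X%:P)) g (expt L) n =
    expt (fun m => iA P *: Lser_coprime P m) n +
    if (d <= n)%N then
      tprod (map_poly polyC P) * expt L (n - d)%N - iter d tphit (expt L (n - d)%N)
    else 0.
  have := expT_act iA_inj (tprod ('X - 'X%:P)) tauZ P L n.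
  rewrite Pg actD actZ act_prod_conj // iter_shift -/tphit.
  rewrite (expT_ext _ _ _ (fun m => Lser_split m PI.2 iA_neq0)) expTD expt_delay => /esym e.
  apply: (addrI (if (d <= n)%N then iter d tphit (expt L (n - d)) else 0)).
  rewrite e -Pg; case: ifP => _; last by rewrite add0r.
  by rewrite [RHS]addrC -addrA subrK.
have actW : act iA tau (tprod ('X - 'X%:P)) g (expt L) n \in W.
  rewrite -[X in X \in W](scalerK iAP0) main scalerDr rpredD //.
    rewrite scaler_sumr rpred_sum // => i _; rewrite (iter_tphiZ _ tauZ) carlitz_D_mem //.
    apply: iter_tphit_mem; rewrite rpred_sum // => a /and3P[_ _ Pa].
    by rewrite WV // tprod_mem.
  case: leqP => [dn|_]; last by rewrite scaler0 rpred0.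
  have eWd : expt L (n - d)%N \in W by rewrite eW // ltn_subrL d0 (leq_trans d0).
  rewrite iter_tphit Pg; set x := expt L _; set u := tprod _; set v := tprod _.
  (* The first summand is 0 mod P since P(t) is congruent to [prod_conj d], the second by
     [Wfermat]. *)
  have -> : u * x - v * iter d tau x = (u - v) * x - v * (iter d tau x - x) by ring.
  rewrite scalerBr scalerAl scalerAr rpredB // rpredM ?tprod_mem ?Wfermat //.
  exact: tprod_congr.
have := act_sub_eval (rpred0 W) (rpredD (S := W)) WZ tphit_mem g eW.
rewrite g1 rmorph1 scale1r -opprB rpredN => h.
by have := rpredD h actW; rewrite subrK.
Qed.

End LocalIntegrality.

End Evaluation.

(** * Integrality in C_infty[t_1, ..., t_r] *)

Section PolynomialRing.
Variables (k : finFieldType) (F : fieldType) (iA : {rmorphism {poly k} -> F}).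
Variable (r : nat).
Local Notation q := #|k|.
Local Notation T := {malg F[{cmonom 'I_r}]}.

Local Notation frob := (frobF iA).

Definition monT (m : {cmonom 'I_r}) : T := << m >>.
Fact monT_is_multiplicative : mmorphism monT.
Proof. by split=> [m m'|]; rewrite /monT // malgM_def fgmulUU mulr1. Qed.
HB.instance Definition _ := isMultiplicative.Build _ T monT monT_is_multiplicative.

Definition malgCF : F -> T := malgC.
Fact malgCF_is_zmod_morphism : zmod_morphism malgCF.
Proof. by move=> a b; rewrite /malgCF raddfB. Qed.
Fact malgCF_is_monoid_morphism : monoid_morphism malgCF.
Proof. by split=> [|a b]; rewrite /malgCF ?mpolyC1E // malgCM. Qed.
HB.instance Definition _ := GRing.isZmodMorphism.Build _ _ malgCF malgCF_is_zmod_morphism.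
HB.instance Definition _ := GRing.isMonoidMorphism.Build _ _ malgCF malgCF_is_monoid_morphism.

Definition tauT : T -> T := mmap (malgCF \o frob) monT.
HB.instance Definition _ := GRing.RMorphism.on tauT.

Lemma tauTZ c f : tauT (c *: f) = c ^+ q *: tauT f.
Proof. by rewrite /tauT mmapZ /= /malgCF mul_malgC. Qed.

Lemma tauTU m : tauT << m >> = << m >>.
Proof. by rewrite /tauT mmapU /= !rmorph1 mul1r. Qed.

Lemma malg_sum (f : T) : f = \sum_(m <- msupp f) f@_m *: << m >>.
Proof.
rewrite [LHS](monalgE f); apply: eq_bigr => m _.
apply/malgP => n; transitivity (f@_m *+ (m == n)); first exact: mcoeffU.
by rewrite (mcoeffZ _ << m >> n) (@mcoeffU1 _ F m n) mulr_natr.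
Qed.

Lemma mcoeff_tauT f m : (tauT f)@_m = f@_m ^+ q.
Proof.
rewrite {1}(malg_sum f) [in RHS](malg_sum f) (raddf_sum tauT) !(raddf_sum (mcoeff m)).
rewrite -[_ ^+ q]/(frob _) (raddf_sum frob).
apply: eq_bigr => n _.
have cU c : (c *: << n >> : T)@_m = c * (n == m)%:R.
  by rewrite mcoeffZ (@mcoeffU1 _ F n m).
transitivity ((f@_n ^+ q *: << n >> : T)@_m).
  by congr mcoeff; apply: etrans (tauTZ _ _) _; rewrite tauTU.
apply: etrans (cU _) (esym (etrans (congr1 frob (cU _)) _)).
by rewrite rmorphM rmorph_nat.
Qed.

Lemma mcoeff_iter_tauT f d m : (iter d tauT f)@_m = f@_m ^+ (q ^ d).
Proof. by elim: d => //= d IH; rewrite mcoeff_tauT IH -exprM -expnSr. Qed.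

Definition tvar (j : 'I_r) : T := << ucm j >>.

Lemma tauT_tvar j : tauT (tvar j) = tvar j.
Proof. exact: tauTU. Qed.

Lemma monalgOver_tvar (S : subringClosed F) j : tvar j \in monalgOver S.
Proof. by rewrite monalgOverU rpred1 orbT. Qed.

End PolynomialRing.

(** * Localisations of A at its primes, and integrality of the v_n *)

Section LocalRings.
Variables (k : finFieldType) (F : fieldType) (iA : {rmorphism {poly k} -> F}).
Hypothesis iA_inj : injective iA.
Local Notation q := #|k|.

Section AtPrime.
Variables (P : {poly k}) (PI : monic_irreducible_poly P).

Let ndvdM b c : ~~ (P %| b) -> ~~ (P %| c) -> ~~ (P %| b * c).
Proof. by rewrite -!(irreducible_poly_coprime _ PI.1) coprimepMr => -> ->. Qed.

Let iA_neq0 b : ~~ (P %| b) -> iA b != 0.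
Proof.
by move=> Pb; rewrite -(rmorph0 iA) (inj_eq iA_inj); apply: contraNneq Pb => ->; rewrite dvdp0.
Qed.

(* The image of the local ring of A at P; the unused argument lets the canonical subring
   structure find the proof that P is irreducible. *)
Definition localA of monic_irreducible_poly P : {pred F} :=
  fun x => `[< exists a b, ~~ (P %| b) /\ x * iA b = iA a >].

Lemma localAP x : reflect (exists a b, ~~ (P %| b) /\ x * iA b = iA a) (x \in localA PI).
Proof. exact: asboolP. Qed.

Lemma ndvd1 : ~~ (P %| 1).
Proof. by rewrite dvdp1; have [[]] := PI; case: size => [|[]]. Qed.

Lemma localA_iA a : iA a \in localA PI.
Proof. by apply/localAP; exists a, 1; rewrite ndvd1 rmorph1 mulr1. Qed.

Lemma localA_inv a : ~~ (P %| a) -> (iA a)^-1 \in localA PI.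
Proof.
by move=> Pa; apply/localAP; exists 1, a; rewrite rmorph1 mulVf ?iA_neq0.
Qed.

Fact localA_subring : subring_closed (localA PI).
Proof.
split=> [|x y /localAP[a [b [Pb e]]] /localAP[a' [b' [Pb' e']]]|
          x y /localAP[a [b [Pb e]]] /localAP[a' [b' [Pb' e']]]].
- by rewrite -(rmorph1 iA) localA_iA.
- apply/localAP; exists (a * b' - a' * b), (b * b'); split; first exact: ndvdM.
  by rewrite rmorphB !rmorphM -e -e'; ring.
- apply/localAP; exists (a * a'), (b * b'); split; first exact: ndvdM.
  by rewrite !rmorphM -e -e'; ring.
Qed.
HB.instance Definition _ := GRing.isSubringClosed.Build _ (localA PI) localA_subring.

(** With Q = q^d, x = a / b, a^Q - a = u P and b^Q - b = v P, the difference x^Q - x equals P (u b -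
    a v) / (b^Q b). *)
Lemma localA_fermat x : x \in localA PI ->
  (iA P)^-1 * (x ^+ (q ^ (size P).-1) - x) \in localA PI.
Proof.
move=> /localAP[a [b [Pb e]]]; set Q := (q ^ _)%N.
have [/dvdpP[u eu] /dvdpP[v ev]] := (dvdp_exp_card_sub PI a, dvdp_exp_card_sub PI b).
have P0 : iA P != 0 by rewrite -(rmorph0 iA) (inj_eq iA_inj) monic_neq0 ?PI.
apply/localAP; exists (u * b - a * v), (b ^+ Q * b); split.
  apply: ndvdM => //; move: Pb; rewrite -!(irreducible_poly_coprime _ PI.1).
  exact: coprimep_expr.
have key : (x ^+ Q - x) * iA (b ^+ Q * b) = iA P * iA (u * b - a * v).
  rewrite -[RHS]rmorphM.
  have -> : P * (u * b - a * v) = (u * P) * b - a * (v * P) by ring.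
  rewrite -eu -ev -/Q !rmorphB !rmorphM !rmorphB !rmorphXn /= -e exprMn.
  by set y := x ^+ Q; set z := _ ^+ Q; ring.
by rewrite -mulrA key mulKf.
Qed.

End AtPrime.

Lemma irreducible_factor (f : {poly k}) : (1 < size f)%N ->
  exists P, monic_irreducible_poly P /\ P %| f.
Proof.
have [n] := ubnP (size f); elim: n f => // n IH f; rewrite ltnS => fn f1.
have [fI|fN] := boolP (irreducibleb f).
  have f0 : f != 0 by rewrite -size_poly_gt0 ltnW.
  have c0 : (lead_coef f)^-1 != 0 by rewrite invr_eq0 lead_coef_eq0.
  have /irreducibleP [_ fI'] := fI.
  exists ((lead_coef f)^-1 *: f); split; last by rewrite dvdpZl.
  split; last by rewrite monicE lead_coefZ mulVf ?lead_coef_eq0.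
  split; first by rewrite size_scale.
  move=> g g1; rewrite dvdpZr // => gf.
  by apply: eqp_trans (fI' g g1 gf) _; rewrite eqp_sym eqp_scale.
have [g [g1 gf gf']] : exists g : {poly k}, [/\ (1 < size g)%N, (size g < size f)%N & g %| f].
  move: fN => /irreducibleP fN; apply: contrapT => h; apply: fN; split=> // g g1 gf.
  have f0 : f != 0 by rewrite -size_poly_gt0 ltnW.
  rewrite -dvdp_size_eqp // eqn_leq dvdp_leq // leqNgt; apply/negP => lt; apply: h.
  exists g; split=> //; move: (dvdpN0 gf f0) g1; rewrite -size_poly_gt0.
  by case: size => [|[]].
have [P [PI Pg]] := IH g (leq_trans gf fn) g1.
by exists P; split=> //; apply: dvdp_trans gf'.
Qed.

(** Induction on the size of a denominator [b]: a prime dividing [b] also divides [a], by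
    integrality of x there, and can be cancelled. *)
Lemma localA_global x :
  (forall P (PI : monic_irreducible_poly P), x \in localA PI) -> exists a, x = iA a.
Proof.
move=> h.
have X_mi : monic_irreducible_poly ('X : {poly k}).
  by split; [rewrite -['X]subr0 -polyC0; exact: irredp_XsubC|exact: monicX].
(* Integrality at any single prime, here theta, supplies a first fraction a / b. *)
have /localAP[a [b [Xb e]]] := h _ X_mi.
have b0 : b != 0 by apply: contraNneq Xb => ->; rewrite dvdp0.
move: b0 e {Xb}; have [n] := ubnP (size b); elim: n a b => // n IH a b; rewrite ltnS => bn b0 e.
have [b1|b1] := leqP (size b) 1.
  have := size1_polyC b1; set c := b`_0 => bc.
  exists (c^-1 *: a); rewrite -mul_polyC rmorphM -e bc /= mulrCA -rmorphM -polyCM mulVf.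
    by rewrite rmorph1 mulr1.
  by move: b0; rewrite bc polyC_eq0.
have [P [PI /dvdpP[b' bb]]] := irreducible_factor b1.
have /localAP[a' [d [Pd e']]] := h _ PI.
have P0 : iA P != 0 by rewrite -(rmorph0 iA) (inj_eq iA_inj) monic_neq0 ?PI.
have /dvdpP[a1 aa] : P %| a.
  have : P %| d * a.
    have -> : d * a = a' * b.
      by apply: iA_inj; rewrite !rmorphM -e -e'; ring.
    by rewrite bb mulrA dvdp_mulIr.
  by rewrite Gauss_dvdpr // (irreducible_poly_coprime _ PI.1).
have b'0 : b' != 0 by move: b0; rewrite bb mulf_eq0 => /norP[].
have sP : (1 < size P)%N by case: PI => -[].
apply: (IH a1 b') => //.
  apply: leq_trans bn; rewrite bb size_mul // ?[P != 0]monic_neq0 ?PI //.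
  by move: sP; case: (size P) => [|[|s]] // _; rewrite !addnS /= ltnS leq_addr.
by apply: (mulIf P0); rewrite -mulrA -!rmorphM -aa -bb.
Qed.

Variable r : nat.
Local Notation T := {malg F[{cmonom 'I_r}]}.
Local Notation tau := (@tauT k F iA r).

Lemma monalgOver_tauT (S : subringClosed F) (x : T) :
  x \in monalgOver S -> tau x \in monalgOver S.
Proof.
by move=> /monalgOverP xS; apply/monalgOverP => m; rewrite mcoeff_tauT rpredX.
Qed.

Definition Sser : nat -> T :=
  expT iA tau (tprod iA (@tvar F r) ('X - 'X%:P)) (Lser iA (@tvar F r)).

(** At each prime P, [W] is taken to be the polynomials in the t_j with coefficients in the local
    ring at P; tau acts on them through the coefficients only. *)
Lemma Sser_integral n m : exists a, (Sser n)@_m = iA a.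
Proof.
apply: localA_global => P PI; move: m; apply/(monalgOverP (localA PI)).
have mZ c (x : T) : c \in localA PI ->
  x \in monalgOver (localA PI) -> c *: x \in monalgOver (localA PI).
  by move=> cO xO; exact: monalgOverZ.
apply: (@expt_Lser_local k F iA T tau r (@tvar F r) (@tauTZ _ _ iA r)
  (@tauT_tvar _ _ iA r) P PI _ iA_inj).
- by move=> a x xO; apply: mZ => //; exact: localA_iA.
- by move=> j; exact: monalgOver_tvar.
- by move=> x; exact: monalgOver_tauT.
- by move=> a x Pa xO; apply: mZ => //; exact: localA_inv.
- move=> x /monalgOverP xO; apply/monalgOverP => m.
  by rewrite mcoeffZ mcoeffB mcoeff_iter_tauT localA_fermat.
Qed.
End LocalRings.

(** * Vanishing of the high coefficients *)

Section AbsoluteValue.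
Variables (k : finFieldType) (F : fieldType) (iA : {rmorphism {poly k} -> F}).
Variables (R : realType) (abs : F -> R).
Local Notation q := #|k|.
Hypothesis abs_ge0 : forall x, 0 <= abs x.
Hypothesis abs_eq0 : forall x, abs x = 0 <-> x = 0.
Hypothesis absM : forall x y, abs (x * y) = abs x * abs y.
Hypothesis absD : forall x y, abs (x + y) <= Num.max (abs x) (abs y).
Hypothesis abs_theta : abs (iA 'X) = q%:R.

Lemma abs0 : abs 0 = 0.
Proof. exact/abs_eq0. Qed.

Lemma abs1 : abs 1 = 1.
Proof.
have a1 : abs 1 != 0 by apply/eqP => /abs_eq0/eqP; rewrite oner_eq0.
by apply: (mulfI a1); rewrite -absM !mulr1.
Qed.

Lemma absX x n : abs (x ^+ n) = abs x ^+ n.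
Proof. by elim: n => [|n IH]; rewrite ?expr0 ?abs1 // !exprS absM IH. Qed.

Lemma absV x : abs x^-1 = (abs x)^-1.
Proof.
have [->|x0] := eqVneq x 0; first by rewrite invr0 abs0 invr0.
have a0 : abs x != 0 by apply/eqP => /abs_eq0/eqP; rewrite (negPf x0).
by apply: (mulfI a0); rewrite -absM !mulfV ?abs1.
Qed.

Lemma absN x : abs (- x) = abs x.
Proof.
have : abs (- x) ^+ 2 == abs x ^+ 2 by rewrite -!absX sqrrN.
by rewrite eqrXn2 // => /eqP.
Qed.

Lemma abs_sum_le (I : Type) (s : seq I) (Q : pred I) (f : I -> F) B :
  0 <= B -> (forall i, Q i -> abs (f i) <= B) -> abs (\sum_(i <- s | Q i) f i) <= B.
Proof.
move=> B0 fB; elim/big_ind: _ => // [|x y xB yB]; first by rewrite abs0.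
by rewrite (le_trans (absD _ _)) // ge_max xB.
Qed.

(** A nonzero constant satisfies c^(q-1) = 1. *)
Lemma abs_const (c : k) : c != 0 -> abs (iA c%:P) = 1.
Proof.
move=> c0; have : abs (iA c%:P) ^+ q.-1 == 1.
  rewrite -absX -rmorphXn -polyC_exp -[_ ^+ _](_ : 1 = _) ?rmorph1 ?abs1 //.
  apply: (mulfI c0); rewrite mulr1 -exprS prednK ?expf_card //.
  by rewrite ltnW ?card_finField_gt1.
rewrite -[1 in X in X -> _](expr1n _ q.-1) eqrXn2 // => [/eqP //|].
by have := card_finField_gt1 k; case: q => [|[]].
Qed.

Lemma abs_const_le1 (c : k) : abs (iA c%:P) <= 1.
Proof.
have [->|/abs_const ->//] := eqVneq c 0.
by rewrite polyC0 rmorph0 abs0.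
Qed.

Let q1 : 1 < q%:R :> R.
Proof. by rewrite ltr1n card_finField_gt1. Qed.
Let q0 : 0 < q%:R :> R.
Proof. exact: lt_trans ltr01 q1. Qed.

Let q_ge0 : 0 <= q%:R :> R := ltW q0.
Let q_ge1 : 1 <= q%:R :> R := ltW q1.
Let qX_ge0 n : 0 <= q%:R ^+ n :> R := exprn_ge0 n q_ge0.
Let qXV_ge0 n : 0 <= q%:R ^- n :> R.
Proof. by rewrite invr_ge0. Qed.
#[local] Hint Resolve q_ge0 q_ge1 qX_ge0 qXV_ge0 : core.

Lemma abs_poly_le (a : {poly k}) n : (size a <= n.+1)%N -> abs (iA a) <= q%:R ^+ n.
Proof.
move=> an; rewrite -[a]coefK poly_def rmorph_sum /= abs_sum_le // => i _.
rewrite -mul_polyC rmorphM rmorphXn absM absX abs_theta.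
rewrite -[X in _ <= X]mul1r ler_pM ?abs_ge0 ?abs_const_le1 //.
by rewrite ler_weXn2l // -ltnS (leq_trans _ an).
Qed.

Lemma abs_poly_lt (a : {poly k}) n : (size a <= n)%N -> abs (iA a) < q%:R ^+ n.
Proof.
case: n => [|n]; first by rewrite size_poly_leq0 => /eqP ->; rewrite rmorph0 abs0.
by move=> /abs_poly_le al; rewrite (le_lt_trans al) // ltr_eXn2l.
Qed.

(** The remainder [b] = theta^n - a has absolute value below q^n, so in |theta^n| <= max(|a|, |b|)
    the maximum must be |a|. *)
Lemma abs_monic (a : {poly k}) : a \is monic -> abs (iA a) = q%:R ^+ (size a).-1.
Proof.
move=> am; set n := (size a).-1.
have sa : size a = n.+1 by rewrite prednK // size_poly_gt0 monic_neq0.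
apply: le_anti; rewrite abs_poly_le ?sa //=.
set b : {poly k} := 'X^n - a.
have sb : (size b <= n)%N.
  apply/leq_sizeP => i; rewrite leq_eqVlt => /orP[/eqP <-|ni].
    by rewrite coefB coefXn eqxx (_ : a`_n = 1) ?subrr // -(monicP am) lead_coefE.
  by rewrite coefB coefXn gtn_eqF // nth_default ?subrr // sa.
have blt := abs_poly_lt sb.
have := absD (iA a) (iA b); rewrite -rmorphD addrC subrK rmorphXn absX abs_theta.
by rewrite le_max => /orP[//|]; rewrite leNgt blt.
Qed.

Lemma abs_poly_ge1 (a : {poly k}) : a != 0 -> 1 <= abs (iA a).
Proof.
move=> a0; have l0 : lead_coef a != 0 by rewrite lead_coef_eq0.
have am : (lead_coef a)^-1 *: a \is monic by rewrite monicE lead_coefZ mulVf.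
have -> : abs (iA a) = abs (iA ((lead_coef a)^-1 *: a)).
  by rewrite -mul_polyC rmorphM absM abs_const ?invr_eq0 // mul1r.
by rewrite abs_monic // exprn_ege1.
Qed.

Lemma carlitz_D_monic i :
  carlitz_D k i \is monic /\ size (carlitz_D k i) = (i * q ^ i).+1.
Proof.
have q1' := card_finField_gt1 k.
elim: i => [|i [IHm IHs]] /=; first by rewrite monic1 size_poly1.
have qi : (1 < q ^ i.+1)%N by rewrite -{1}(exp1n i.+1) ltn_exp2r.
have sX : size ('X ^+ (q ^ i.+1) - 'X : {poly k}) = (q ^ i.+1).+1.
  by rewrite size_polyDl ?size_polyXn // size_polyN size_polyX.
have mX : 'X ^+ (q ^ i.+1) - 'X \is @monic k.
  by rewrite monicE lead_coefDl ?lead_coefXn // size_polyN size_polyX size_polyXn.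
split; first by rewrite monicMl // monic_exp.
have D0 : carlitz_D k i ^+ q != 0 by rewrite expf_neq0 ?carlitz_D_neq0.
have sD : size (carlitz_D k i ^+ q) = (i * q ^ i * q).+1.
  by rewrite -[LHS]prednK ?size_poly_gt0 // size_exp IHs.
by rewrite size_monicM // sX sD addSn addnS /= mulSn -mulnA -expnSr.
Qed.

Lemma abs_carlitz_D i : abs (iA (carlitz_D k i)) = q%:R ^+ (i * q ^ i).
Proof. by have [m s] := carlitz_D_monic i; rewrite abs_monic // s. Qed.

Variable r : nat.
Local Notation T := {malg F[{cmonom 'I_r}]}.
Local Notation tau := (@tauT k F iA r).
Local Notation tv := (@tvar F r).

(** A bound on the Gauss norm, without forming the norm as a maximum. *)
Definition gauss_le (B : R) (x : T) := forall m, abs x@_m <= B.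

Lemma gauss_leW B C x : B <= C -> gauss_le B x -> gauss_le C x.
Proof. by move=> BC xB m; apply: le_trans BC. Qed.

Lemma gauss_le_sum (I : Type) (s : seq I) (Q : pred I) (f : I -> T) B :
  0 <= B -> (forall i, Q i -> gauss_le B (f i)) -> gauss_le B (\sum_(i <- s | Q i) f i).
Proof.
by move=> B0 fB m; rewrite (raddf_sum (mcoeff m)) abs_sum_le // => i /fB; apply.
Qed.

Lemma gauss_leM B C x y : 0 <= B -> 0 <= C ->
  gauss_le B x -> gauss_le C y -> gauss_le (B * C) (x * y).
Proof.
move=> B0 C0 xB yC m; rewrite mcoeffMl abs_sum_le ?mulr_ge0 // => i _.
rewrite abs_sum_le ?mulr_ge0 // => j _; case: eqP => _; last by rewrite abs0 mulr_ge0.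
by rewrite absM ler_pM.
Qed.

Lemma gauss_leZ B c x : gauss_le B x -> gauss_le (abs c * B) (c *: x).
Proof. by move=> xB m; rewrite mcoeffZ absM ler_wpM2l. Qed.

Lemma gauss_le_tau B x : gauss_le B x -> gauss_le (B ^+ q) (tau x).
Proof.
by move=> xB m; rewrite mcoeff_tauT absX lerXn2r ?nnegrE // (le_trans _ (xB m)).
Qed.

Lemma gauss_le1 : gauss_le 1 1.
Proof. by move=> m; rewrite mcoeff1; case: eqP; rewrite ?abs1 ?abs0. Qed.

Lemma gauss_le_tvarX j n : gauss_le 1 (tv j ^+ n).
Proof.
elim: n => [|n IH]; first exact: gauss_le1.
rewrite exprS -[1]mul1r; apply: gauss_leM => // m.
by rewrite mcoeffU1; case: eqP; rewrite ?abs1 ?abs0.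
Qed.

Lemma gauss_le_evalt B j (h : {poly F}) : 0 <= B ->
  (forall i, abs h`_i <= B) -> gauss_le B (evalt tv j h).
Proof.
move=> B0 hB; rewrite evaltE; apply: gauss_le_sum => // i _.
apply: gauss_leW (gauss_leZ _ (gauss_le_tvarX j i)).
by rewrite mulr1.
Qed.

Lemma gauss_le_tprod B (h : {poly {poly k}}) : 0 <= B ->
  (forall i, abs (iA h`_i) <= B) -> gauss_le (B ^+ r) (tprod iA tv h).
Proof.
move=> B0 hB; rewrite -[r in _ ^+ r](card_ord r) -prodr_const /tprod.
suff [] : 0 <= \prod_(j < r) B /\ gauss_le (\prod_(j < r) B)
   (\prod_(j < r) evalt tv j (map_poly iA h)) by [].
elim/big_ind2: _ => [|x y x' y' [x0 xy] [x'0 x'y']|j _].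
- by split=> //; exact: gauss_le1.
- by split; [exact: mulr_ge0|exact: gauss_leM].
by split=> //; apply: gauss_le_evalt => // i; rewrite coef_map; exact: hB.
Qed.

Local Notation tph := (@tphit k F iA T tau r tv).

(** Each of the r factors t_j - theta has coefficients of absolute value at most q, and tau raises
    those of [x] to the power q. *)
Lemma gauss_le_tphit B x : 0 <= B -> gauss_le B x -> gauss_le (q%:R ^+ r * B ^+ q) (tph x).
Proof.
move=> B0 xB; apply: gauss_leM; rewrite ?exprn_ge0 //; last exact: gauss_le_tau.
apply: gauss_le_tprod => // i.
rewrite coefB coefX coefC rmorphB (le_trans (absD _ _)) // absN ge_max.
by case: i => [|[|i]] /=; rewrite ?rmorph0 ?rmorph1 ?abs0 ?abs1 ?abs_theta ?lexx ?q_ge0 ?q_ge1.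
Qed.

(** The sum 1 + q + ... + q^(i-1), in the form produced by iterating [gauss_le_tphit]. *)
Fixpoint geom (i : nat) : nat := if i is i'.+1 then (1 + q * geom i')%N else 0%N.

Lemma geom_lt i : (geom i < q ^ i)%N.
Proof.
have q1' := card_finField_gt1 k.
elim: i => //= i IH; rewrite expnS.
have le : (q * (geom i).+1 <= q * q ^ i)%N by rewrite leq_mul2l IH orbT.
by apply: leq_trans le; rewrite mulnS ltn_add2r.
Qed.

Lemma gauss_le_iter_tphit B x i : 0 <= B -> gauss_le B x ->
  gauss_le (q%:R ^+ (r * geom i) * B ^+ (q ^ i)) (iter i tph x).
Proof.
move=> B0 xB; elim: i => [|i IH] /=; first by rewrite muln0 mul1r.
have := gauss_le_tphit _ IH; rewrite mulr_ge0 ?exprn_ge0 // => /(_ isT).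
apply: gauss_leW; rewrite exprMn -!exprM -expnSr mulrA -exprD.
by rewrite [X in _ ^+ X](_ : _ = (r * (1 + q * geom i))%N) //; lia.
Qed.

Lemma gauss_le_Lser n : gauss_le (q%:R ^- n) (Lser iA tv n).
Proof.
apply: gauss_le_sum => // a /andP[/eqP sa am].
rewrite -[q%:R ^- n]mulr1 -[X in X * _](_ : abs (iA (polyn a))^-1 = _); last first.
  by rewrite absV abs_monic // sa.
apply: gauss_leZ; rewrite -(expr1n _ r); apply: gauss_le_tprod => // i.
by rewrite coef_map abs_const_le1.
Qed.

(** As |D_i| = q^(i q^i) and L_(n-i) has norm at most q^(-(n-i)), the i-th term is bounded by q to
    the power r [geom i] - n q^i. This exponent is at most -1, since [geom i] < q^i and n > r. *)
Lemma Sser_small n : (r < n)%N -> gauss_le q%:R^-1 (Sser iA r n).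
Proof.
move=> rn; apply: gauss_le_sum => [|i _]; first by rewrite invr_ge0.
have := gauss_leZ (iA (carlitz_D k i))^-1
  (gauss_le_iter_tphit i (qXV_ge0 _) (gauss_le_Lser (n - i))).
apply: gauss_leW; rewrite absV abs_carlitz_D exprVn -exprM.
rewrite mulrCA -invfM -exprD -mulnDl subnKC; last by rewrite -ltnS.
rewrite ler_pdivrMr ?exprn_gt0 // mulrC ler_pdivlMr // -exprSr ler_weXn2l //.
have := geom_lt i; nia.
Qed.

Lemma Sser_eq0 n : injective iA -> (r < n)%N -> Sser iA r n = 0.
Proof.
move=> iA_inj rn; apply/malgP => m; rewrite mcoeff0.
have [a e] := Sser_integral iA_inj n m; have le := Sser_small rn m.
rewrite e in le *; have [->|a0] := eqVneq a 0; first by rewrite rmorph0.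
by have := le_trans (abs_poly_ge1 a0) le; rewrite leNgt invf_lt1 ?q1.
Qed.

End AbsoluteValue.

(** * From the t_j back to the X_j *)

Section Transfer.
Variables (k : finFieldType) (C : fieldType) (iota : {rmorphism {fraction {poly k}} -> C}).
Variable r : nat.
Local Notation q := #|k|.
Local Notation B := (Bring C r).
Local Notation T := {malg C[{cmonom 'I_r}]}.
Local Notation tauX := (@tauX C r).

Variable iA : {rmorphism {poly k} -> C}.
Hypothesis iAE : forall a, iota (tofrac a) = iA a.

Local Notation tau := (@tauT k C iA r).
Local Notation tv := (@tvar C r).
Local Notation tph := (@tphit k C iA T tau r tv).

Variable phi : {rmorphism B -> B}.
Hypothesis phiE : phi =1 @tauB k C r.
Hypothesis phiC : forall c, phi c%:MP = (c ^+ q)%:MP.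
Hypothesis phiX : forall j m, phi (tauX j m) = tauX j m.+1.

Lemma phiZ c (b : B) : phi (c *: b) = c ^+ q *: phi b.
Proof. by rewrite -!mul_malgC rmorphM /= phiC. Qed.

(* C_{theta^n}(X_j) *)
Definition carlitzX (j : 'I_r) (n : nat) : B :=
  lincomb iA (tauX j) (iter n (tmul (carlitz_theta k)) 1).

(** Left multiplication by theta + tau in A[tau] becomes b |-> theta b + tau(b) on B_r. *)
Lemma lincomb_tmul j f :
  lincomb iA (tauX j) (tmul (carlitz_theta k) f) =
  iA 'X *: lincomb iA (tauX j) f + phi (lincomb iA (tauX j) f).
Proof.
have s2 : size (carlitz_theta k) = 2%N by rewrite /carlitz_theta addrC size_XaddC.
rewrite /tmul s2 big_ord_recl big_ord1 raddfD; congr (_ + _).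
  rewrite [LHS]raddf_sum scaler_sumr; apply: eq_bigr => i _.
  rewrite /= lincombZ lincombXn /carlitz_theta coefD coefC coefX addr0 expr1.
  by rewrite rmorphM scalerA.
rewrite [LHS]raddf_sum [RHS]raddf_sum; apply: eq_bigr => i _.
rewrite /= lincombZ lincombXn /carlitz_theta coefD coefC coefX add0r mul1r.
by rewrite phiZ phiX expn1 -rmorphXn.
Qed.

Lemma carlitzXS j n :
  carlitzX j n.+1 = iA 'X *: carlitzX j n + phi (carlitzX j n).
Proof. exact: lincomb_tmul. Qed.

Lemma carlitz_atE (a : {poly k}) j :
  carlitz_at iota a j = \sum_(n < size a) iA (a`_n)%:P *: carlitzX j n.
Proof.
transitivity (lincomb iA (tauX j) (carlitz a)).
  by apply: eq_bigr => i _; rewrite iAE.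
by rewrite /carlitz raddf_sum; apply: eq_bigr => n _; rewrite /= lincombZ.
Qed.

Lemma prod_tvarX (e : 'I_r -> nat) :
  exists2 m : {cmonom 'I_r}, \prod_j tv j ^+ e j = << m >> & forall j, m j = e j.
Proof.
have tvX j n : exists2 m : {cmonom 'I_r}, tv j ^+ n = << m >> &
    forall i, m i = ((i == j) * n)%N.
  elim: n => [|n [m em mi]]; first by exists mone => // i; rewrite cm1 muln0.
  exists (mmul (ucm j) m).
    by rewrite exprS em; exact: esym (mmorphM (@monT C r) (ucm j) m).
  by move=> i; rewrite cmM cmU mi mulnS eq_sym.
have W (s : seq 'I_r) : exists2 m : {cmonom 'I_r}, \prod_(j <- s) tv j ^+ e j = << m >> &
    forall i, m i = (\sum_(j <- s) (i == j) * e j)%N.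
  elim: s => [|j s [m em mi]].
    by exists mone => [|i]; rewrite big_nil ?cm1.
  have [n en ni] := tvX j (e j); exists (mmul n m).
    by rewrite big_cons em en; exact: esym (mmorphM (@monT C r) n m).
  by move=> i; rewrite cmM ni mi big_cons.
have [m em mi] := W (index_enum _); exists m => // i.
rewrite mi (bigD1 i) //= eqxx mul1n big1 ?addn0 // => j.
by rewrite eq_sym => /negPf ->.
Qed.

Lemma monT_prod (m : {cmonom 'I_r}) : << m >> = \prod_j tv j ^+ m j.
Proof.
have [n en nm] := prod_tvarX m.
have mn : n = m by apply/eqP/cmP => j; rewrite nm.
by apply: esym; rewrite {}mn in en.
Qed.

(** This map is linear but not multiplicative: t_j^2 goes to C_(theta^2)(X_j), not to the square of
    C_theta(X_j). Hence [mmap] is used only as linear extension from monomials. *)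
Definition Phi (x : T) : B :=
  mmap (malgC : C -> B) (fun m : {cmonom 'I_r} => \prod_j carlitzX j (m j)) x.

Fact Phi_is_zmod_morphism : zmod_morphism Phi.
Proof. exact: raddfB. Qed.
HB.instance Definition _ := GRing.isZmodMorphism.Build _ _ Phi Phi_is_zmod_morphism.

Lemma PhiEw (d : {fset {cmonom 'I_r}}) x : (msupp x `<=` d)%fset ->
  Phi x = \sum_(m <- d) x@_m *: \prod_j carlitzX j (m j).
Proof.
move=> xd; rewrite /Phi (mmapEw xd); apply: eq_bigr => m _; exact: mul_malgC.
Qed.

Lemma PhiZ c x : Phi (c *: x) = c *: Phi x.
Proof.
rewrite (PhiEw (msuppZ_le c x)) (PhiEw (fsubset_refl _)) scaler_sumr.
apply: eq_bigr => m _; rewrite [RHS]scalerA.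
by rewrite -(mcoeffZ c x m).
Qed.

Lemma Phi_prod (e : 'I_r -> nat) : Phi (\prod_j tv j ^+ e j) = \prod_j carlitzX j (e j).
Proof.
have [m -> mi] := prod_tvarX e; rewrite /Phi mmapU /= mpolyC1E mul1r.
by apply: eq_bigr => j _; rewrite mi.
Qed.

Local Notation ev j := (lincomb (idfun : {rmorphism C -> C}) (carlitzX j)).

(** Across distinct variables [Phi] is multiplicative, as expanding both products into monomials
    shows. *)
Lemma Phi_prod_evalt (h : 'I_r -> {poly C}) :
  Phi (\prod_j evalt tv j (h j)) = \prod_j ev j (h j).
Proof.
pose N := (\max_j size (h j))%N.
have hN j : (size (h j) <= N)%N by rewrite /N (leq_bigmax j).
have evN j : evalt tv j (h j) = \sum_(i < N) (h j)`_i *: tv j ^+ i.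
  have := lincomb_widen (idfun : {rmorphism C -> C}) (fun i => tv j ^+ i) (hN j).
  by rewrite /lincomb evaltE.
under eq_bigr do rewrite evN.
under [RHS]eq_bigr do rewrite (lincomb_widen _ _ (hN _)).
rewrite !bigA_distr_bigA raddf_sum; apply: eq_bigr => f _ /=.
by rewrite !scaler_prod PhiZ Phi_prod.
Qed.

(** On a monomial, the factor t_j - theta turns C_(theta^n)(X_j) into C_(theta^(n+1))(X_j) - theta
    C_(theta^n)(X_j), which is tau(C_(theta^n)(X_j)). Both sides are q-semilinear, so monomials
    suffice. *)
Lemma Phi_tphit x : Phi (tph x) = phi (Phi x).
Proof.
have on_mon (e : 'I_r -> nat) :
    Phi (tph (\prod_j tv j ^+ e j)) = phi (Phi (\prod_j tv j ^+ e j)).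
  rewrite Phi_prod rmorph_prod /tphit /tphi rmorph_prod -big_split /=.
  under eq_bigr => j _.
    rewrite (rmorphXn tau) /= tauT_tvar -(evaltX tv j) -rmorphXn -rmorphM /=.
    over.
  rewrite Phi_prod_evalt; apply: eq_bigr => j _.
  rewrite rmorphB /= map_polyX map_polyC /= mulrBl -exprS mul_polyC raddfB /= lincombZ !lincombXn.
  by rewrite carlitzXS addrC addKr.
have onU c (m : {cmonom 'I_r}) : Phi (tph (c *: << m >>)) = phi (Phi (c *: << m >>)).
  rewrite monT_prod; set t := \prod_j _.
  rewrite (PhiZ c t) phiZ -on_mon -PhiZ; congr Phi.
  exact: (tphiZ _ (@tauTZ _ _ iA r)).
rewrite (malg_sum x) (raddf_sum tph) !(raddf_sum Phi) (raddf_sum phi).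
apply: eq_bigr => m _; exact: onU.
Qed.

Lemma calL_Phi d : calL iota r d = Phi (Lser iA tv d).
Proof.
rewrite /Lser (raddf_sum Phi); apply: eq_bigr => a _; rewrite iAE [RHS]PhiZ; congr (_ *: _).
rewrite /tprod Phi_prod_evalt; apply: eq_bigr => j _; rewrite carlitz_atE.
rewrite (@lincomb_widen _ _ _ _ _ (size (polyn a))); last first.
  by rewrite (leq_trans (size_poly _ _)) // size_poly.
by apply: eq_bigr => n _; rewrite !coef_map.
Qed.

Lemma iter_tauA (f : Aring C r) i n : (i <= n)%N ->
  iter i (@tauA k C r) f n = iter i phi (f (n - i)%N).
Proof.
elim: i n => [|i IH] [|n] //=.
by rewrite ltnS subSS => /IH ->; rewrite phiE.
Qed.

Lemma calS_Phi n : calS iota r n = Phi (Sser iA r n).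
Proof.
rewrite /calS /expC /Sser /expT (raddf_sum Phi); apply: eq_bigr => i _.
have i_n : (i <= n)%N by rewrite -ltnS.
have iter_Phi j x : iter j phi (Phi x) = Phi (iter j tph x).
  elim: j => [//|j IH].
  exact: etrans (congr1 phi IH) (esym (Phi_tphit _)).
rewrite (iter_tauA (calL iota r) i_n) calL_Phi iter_Phi iAE.
by apply: esym; exact: PhiZ.
Qed.

Definition intA : {pred C} := fun x => `[< exists a, x = iA a >].

Fact intA_subring : subring_closed intA.
Proof.
split=> [|x y /asboolP[a ->] /asboolP[b ->]|x y /asboolP[a ->] /asboolP[b ->]]; apply/asboolP.
- by exists 1; rewrite rmorph1.
- by exists (a - b); rewrite rmorphB.
- by exists (a * b); rewrite rmorphM.
Qed.
HB.instance Definition _ := GRing.isSubringClosed.Build _ intA intA_subring.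

Lemma intA_iA a : iA a \in intA.
Proof. by apply/asboolP; exists a. Qed.

Lemma in_AX_monalgOver (b : B) : b \in monalgOver intA -> in_AX iota b.
Proof.
by move=> /monalgOverP h m; have /asboolP[a ->] := h m; exists a; rewrite iAE.
Qed.

Lemma carlitzX_mem j n : carlitzX j n \in monalgOver intA.
Proof.
rewrite rpred_sum // => i _; rewrite monalgOverZ ?intA_iA //.
by rewrite monalgOverU rpred1 orbT.
Qed.

Lemma Phi_mem x : x \in monalgOver intA -> Phi x \in monalgOver intA.
Proof.
move=> /monalgOverP xA; rewrite /Phi mmapE rpred_sum // => m _.
by rewrite mul_malgC monalgOverZ ?xA // rpred_prod // => j _; exact: carlitzX_mem.
Qed.

End Transfer.

Theorem theorem8p1 (k : finFieldType) (R : realType) (Cinf : fieldType)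
    (iota : {rmorphism {fraction {poly k}} -> Cinf}) (abs : Cinf -> R)
    (hC : is_Cinfty iota abs) (r : nat) :
  in_AXZ iota (calS iota r).
Proof.
pose iA : {rmorphism {poly k} -> Cinf} := iota \o @tofrac {poly k}.
have iA_inj : injective iA by move=> a b /fmorph_inj/eqP; rewrite tofrac_eq => /eqP.
have iAE a : iota (tofrac a) = iA a by [].
have [phi [phiE phiC phiX]] := tauB_rmorphism iota r.
have phiC' c : phi c%:MP = (c ^+ #|k|)%:MP by rewrite phiE.
have phiX' j m : phi (tauX Cinf j m) = tauX Cinf j m.+1 by rewrite phiE.
have SPhi := calS_Phi iAE phiE phiC' phiX'.
split=> [n|].
  rewrite SPhi; apply/(in_AX_monalgOver iAE)/Phi_mem/monalgOverP => m.
  by apply/asboolP; have [a ->] := Sser_integral iA_inj n m; exists a.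
exists r.+1 => n rn; rewrite SPhi.
have [abs_ge0 abs_eq0 absM absD abs_theta _ _ _] := hC.
by rewrite (Sser_eq0 (iA := iA) abs_ge0 abs_eq0 absM absD abs_theta iA_inj rn) raddf0.
Qed.
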